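(* For an irreducible, positive recurrent Markov chain $\{X_t\}$ with countable state space $\Sigma$ and transition probability matrix $P$, and for any $i\in\Sigma$ and $k\in\mathbb Z_+$, $$1-\frac{\mathbb E_i[\hat T_i^{(k)}]}{\mathbb E_i[T_i]}=\mathbb P_i\big(T_i>\theta^{(k)}\big)\,\Gamma_i(\theta^{(k)}),$$ where $$\Gamma_i(\theta)=\sum_{q\in\Sigma\setminus\{i\}}\mathbb P_i\left(X_\theta=q\mid T_i>\theta\right)(Z_{ii}-Z_{qi}).$$
   Context: $\mathbb P_i(\cdot)=\mathbb P(\cdot\mid X_0=i)$ and $\mathbb E_i[\cdot]=\mathbb E[\cdot\mid X_0=i]$; $T_i=\inf\{t\ge1:X_t=i\}$; $\pi$ is the unique stationary distribution; $\mathbb Z_+$ denotes the positive integers and $k$ is an iteration index. $\theta^{(k)}=2^k$ is the truncation threshold at iteration $k$, and $\hat T_i^{(k)}$ is the sample average of independent copies of $\min(T_i,\theta^{(k)})$ (chain started at $i$) collected at iteration $k$, so that $\mathbb E_i[\hat T_i^{(k)}]=\mathbb E_i[\min(T_i,\theta^{(k)})]$. $Z$ is the fundamental matrix, with entries $Z_{jl}=\sum_{t=0}^\infty(P^t_{jl}-\pi_l)$, where $P^t_{jl}$ is the $(j,l)$ entry of $P^t$.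
   Formalization: The formal theorem assumes that the series defining Z_ji converges for every j; for some irreducible positive recurrent chains (e.g. the periodic two-state swap) it diverges, so Z and the right-hand side are undefined. *)

(* Defs.v *)
From HB Require Import structures.
From mathcomp Require Import all_boot all_order all_algebra.
From mathcomp Require Import all_classical all_reals all_analysis.

Set Implicit Arguments.
Unset Strict Implicit.
Unset Printing Implicit Defensive.
Import Order.TTheory GRing.Theory Num.Theory.
Import numFieldNormedType.Exports.
Local Open Scope classical_set_scope.
Local Open Scope ring_scope.

Section TransitionMatrix.
Context {R : realType} {S : countType}.
Implicit Types (p : S -> S -> R) (pi : S -> R).

Definition stochastic p : Prop :=
  (forall j l, 0 <= p j l) /\
  (forall j, \esum_(l in [set: S]) (p j l)%:E = 1%E).

Fixpoint mpow p (t : nat) (j l : S) : R :=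
  if t is t'.+1 then fine (\esum_(m in [set: S]) (p j m * mpow p t' m l)%:E)
  else (j == l)%:R.

Definition irreducible_chain p : Prop :=
  forall j l, exists t, 0 < mpow p t j l.

Definition stationary p pi : Prop :=
  [/\ forall j, 0 <= pi j,
      \esum_(j in [set: S]) (pi j)%:E = 1%E &
      forall l, \esum_(j in [set: S]) (pi j * p j l)%:E = (pi l)%:E].

Definition fundamental_series p pi (j l : S) : R^nat :=
  series (fun t => mpow p t j l - pi l).

(* [limn] is total: the value is meaningful only where the series converges. *)
Definition fundamental_mx p pi (j l : S) : R :=
  limn (fundamental_series p pi j l).

(* [esum] is a supremum over finite subsets, so it is the sum only for
   nonnegative terms; a signed family is split into its two parts. The result is
   finite iff the family is absolutely summable ([+oo - +oo] is [-oo]). *)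
Definition signed_esum (A : set S) (f : S -> R) : \bar R :=
  (\esum_(q in A) (Num.max (f q) 0)%:E -
   \esum_(q in A) (Num.max (- f q) 0)%:E)%E.

End TransitionMatrix.

Section Chain.
Context {d : measure_display} {Omega : measurableType d} {R : realType}.
Context {S : countType}.
Implicit Types (Pr : probability Omega R) (X : nat -> Omega -> S).

(* 0 by convention when [Pr B = 0]. *)
Definition cond_prob Pr (A B : set Omega) : R :=
  fine (Pr (A `&` B)) / fine (Pr B).

Definition history X (n : nat) (x : nat -> S) : set Omega :=
  [set w | forall t, (t <= n)%N -> X t w = x t].

Definition markov_chain Pr X (p : S -> S -> R) : Prop :=
  (forall t s, measurable (X t @^-1` [set s])) /\
  (forall n x, (0 < Pr (history X n x))%E ->
     cond_prob Pr (X n.+1 @^-1` [set x n.+1]) (history X n x)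
     = p (x n) (x n.+1)).

(* One process under a family of laws: [Pr_ j] is the law given [X 0 = j]. It is
   defined for every [j], whether or not an initial law charges [j]. *)
Definition markov_family (Pr_ : S -> probability Omega R) X (p : S -> S -> R)
    : Prop :=
  stochastic p /\
  (forall j, Pr_ j (X 0%N @^-1` [set j]) = 1%E /\ markov_chain (Pr_ j) X p).

(* The infimum of the empty set is [+oo]. *)
Definition return_time X (i : S) (w : Omega) : \bar R :=
  ereal_inf [set t%:R%:E | t in [set t | (1 <= t)%N /\ X t w = i]].

Definition mean_return_time Pr X (i : S) : \bar R :=
  (\int[Pr]_w return_time X i w)%E.

Definition positive_recurrent (Pr_ : S -> probability Omega R) X : Prop :=
  forall j, (mean_return_time (Pr_ j) X j < +oo)%E.

Definition survival X (i : S) (theta : nat) : set Omega :=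
  [set w | (theta%:R%:E < return_time X i w)%E].

(* The minimum is always finite, so [fine] loses nothing. *)
Definition truncated_return_time X (i : S) (theta : nat) (w : Omega) : R :=
  fine (Order.min (return_time X i w) theta%:R%:E).

Definition Gamma Pr X (p : S -> S -> R) (pi : S -> R) (i : S) (theta : nat)
    : \bar R :=
  signed_esum [set~ i] (fun q =>
    cond_prob Pr (X theta @^-1` [set q]) (survival X i theta) *
    (fundamental_mx p pi i i - fundamental_mx p pi q i)).

End Chain.

(* [R] is only the type of the time scale: it cannot be inferred. *)
Arguments survival {d Omega} R {S} X i theta.

Section Sample.
Context {d d' : measure_display} {Omega : measurableType d}
  {Omega' : measurableType d'} {R : realType}.

(* [Y 0, Y 1, ...] are independent copies of [V], observed on a space of their
   own, and [N] is the number of them that are used. [N] may be random, provided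
   that it is independent of the copies. Taking [B s = setT] for some [s] gives
   the product rule for every finite subfamily. *)
Definition independent_copies (Pr : probability Omega R) (V : Omega -> R)
    (Q : probability Omega' R) (N : {RV Q >-> nat}) (Y : nat -> {RV Q >-> R})
    : Prop :=
  [/\ forall w, (0 < N w)%N,
      forall s (B : set R), measurable B -> Q (Y s @^-1` B) = Pr (V @^-1` B) &
      forall (M : set nat) (m : nat) (B : nat -> set R),
        (forall s, measurable (B s)) ->
        Q (N @^-1` M `&` \bigcap_(s < m) (Y s @^-1` B s))
        = (Q (N @^-1` M) * \prod_(s < m) Q (Y s @^-1` B s))%E].

Definition sample_average (Q : probability Omega' R) (N : {RV Q >-> nat})
    (Y : nat -> {RV Q >-> R}) (w : Omega') : R :=
  (\sum_(s < N w) Y s w) / (N w)%:R.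

End Sample.

(* Main.v *)
(** Let [u_n(q)] be the probability, started at [q], of avoiding [i] at the
    times [1, ..., n], and [G_q(n) = \sum_(t <= n) P^t_qi]. Conditioning on the
    first step gives, by induction on [n],
      [\sum_(s <= n) u_s(q) P^(n-s)_ii + G_q(n) = G_i(n) + [q = i]].
    The right-hand side minus [G_q(n)] tends to [Z_ii - Z_qi + [q = i]], while
    [P^t_ii] tends to [pi_i], so the convolution yields
      [pi_i E_q[T_i] = Z_ii - Z_qi + [q = i]].
    For [q = i] this is Kac's formula [pi_i E_i[T_i] = 1], hence [pi_i > 0], and
    then for [q <> i] it forces [E_q[T_i]] to be finite. By the Markov property
    at time [theta], [P_i(T_i > theta) Gamma_i(theta)] is
    [pi_i E_i[(T_i - theta)^+] = 1 - E_i[min(T_i, theta)] / E_i[T_i]]. *)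

Require Import Defs.
From mathcomp Require Import all_boot all_order all_algebra.
From mathcomp Require Import zify ring.
From mathcomp Require Import all_classical all_reals all_analysis.
From mathcomp Require Import measurable_realfun.
Import Order.TTheory GRing.Theory Num.Theory.
Import numFieldNormedType.Exports.
Local Open Scope classical_set_scope.
Local Open Scope ring_scope.

(** * Finite indicator sums and nonnegative families in the extended reals *)

Lemma sum_ltn_natr (R : pzSemiRingType) (m t : nat) :
  \sum_(n < m) (n < t)%N%:R = (minn m t)%:R :> R.
Proof.
rewrite -natr_sum; congr _%:R.
rewrite -(big_mkord xpredT (fun n => nat_of_bool (n < t)%N)).
elim: m => [|m ih]; first by rewrite big_geq// min0n.
by rewrite big_nat_recr//= ih; lia.
Qed.

(** One inequality follows from finite subsums. The other is the same inequality for the factor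
    [c^-1] and the family [c * a], which leaves [c = 0] apart. *)
Lemma esumZl (R : realType) (T : choiceType) (A : set T) (c : R)
    (a : T -> \bar R) :
  0 <= c -> (forall t, (0 <= a t)%E) ->
  (\esum_(t in A) (c%:E * a t) = c%:E * \esum_(t in A) a t)%E.
Proof.
have le (e : R) (b : T -> \bar R) : 0 <= e -> (forall t, (0 <= b t)%E) ->
    (\esum_(t in A) (e%:E * b t) <= e%:E * \esum_(t in A) b t)%E.
  move=> e0 b0; apply: ge_ereal_sup => _ [F FA] <-.
  rewrite -ge0_mule_fsumr//; apply: lee_wpmul2l; first by rewrite lee_fin.
  by apply: esum_ge; exists F.
move=> c0 a0; apply/eqP; rewrite eq_le le//=.
move: c0; rewrite [0 <= c]le_eqVlt => /orP[/eqP<-|c0].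
  by rewrite mul0e esum_ge0// => t _; rewrite mul0e.
have cK (x y : R) (e : \bar R) : x * y = 1 -> (x%:E * (y%:E * e) = e)%E.
  by move=> xy; rewrite muleA -EFinM xy mul1e.
have ca0 t : (0 <= c%:E * a t)%E by rewrite mule_ge0// lee_fin ltW.
have := le c^-1 (fun t => c%:E * a t)%E; rewrite invr_ge0 (ltW c0) => /(_ isT).
move=> /(_ ca0).
rewrite (eq_esum (b := a)) => [|t _]; last by rewrite cK// mulVf ?gt_eqF.
move=> /(@lee_wpmul2l _ c%:E); rewrite lee_fin (ltW c0) => /(_ isT).
by rewrite cK// mulfV ?gt_eqF.
Qed.

Lemma esum_exchange (R : realType) (T1 T2 : choiceType) (A : set T1)
    (B : set T2) (a : T1 -> T2 -> \bar R) :
  (forall i j, (0 <= a i j)%E) ->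
  (\esum_(i in A) \esum_(j in B) a i j =
   \esum_(j in B) \esum_(i in A) a i j)%E.
Proof.
move=> a0; rewrite !esum_esum//.
rewrite (@reindex_esum _ _ _ (A `*`` fun=> B) (B `*`` fun=> A)
  (fun x => (x.2, x.1)))//.
split=> //.
- by move=> [x y] [/= Ax By].
- by move=> [x y] [x' y'] _ _ [-> ->].
- by move=> [y x] [/= By Ax]; exists (x, y).
Qed.

(** * Averages against the rows of [p] and the first-passage decomposition *)

Section Average.
Context {R : realType} {S : countType} (p : S -> S -> R).
Hypothesis hp : stochastic p.

(** Nonnegativity makes [esum] a genuine sum and the bound makes it finite, so that [fine] loses
    nothing in [average]. *)
Definition bounded_weight (f : S -> R) : Prop :=
  (forall l, 0 <= f l) /\ exists C, forall l, f l <= C.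

Definition average (f : S -> R) (q : S) : R :=
  fine (\esum_(l in [set: S]) (p q l * f l)%:E).

Lemma average_esum f q : bounded_weight f ->
  (average f q)%:E = (\esum_(l in [set: S]) (p q l * f l)%:E)%E.
Proof.
move=> [f0 [C fC]]; rewrite fineK//.
have pf0 l : (0 <= (p q l * f l)%:E)%E by rewrite lee_fin mulr_ge0//; apply hp.1.
rewrite ge0_fin_numE ?esum_ge0//.
apply: (@le_lt_trans _ _ (\esum_(l in [set: S]) (C%:E * (p q l)%:E))%E).
  by apply: le_esum => l _; rewrite lee_fin mulrC ler_wpM2r//; apply hp.1.
have C0 : 0 <= C := le_trans (f0 q) (fC q).
by rewrite esumZl// ?hp.2 ?mule1 ?ltry// => l; rewrite lee_fin; apply hp.1.
Qed.

Lemma average_ge0 f q : bounded_weight f -> 0 <= average f q.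
Proof.
move=> bf; rewrite -lee_fin average_esum// esum_ge0// => l _.
by rewrite lee_fin mulr_ge0//; [apply hp.1|apply bf.1].
Qed.

Lemma bounded_weightD f g : bounded_weight f -> bounded_weight g ->
  bounded_weight (fun l => f l + g l).
Proof.
move=> [f0 [C fC]] [g0 [D gD]]; split=> [l|]; first by rewrite addr_ge0.
by exists (C + D) => l; rewrite lerD.
Qed.

Lemma bounded_weightM f g : bounded_weight f -> bounded_weight g ->
  bounded_weight (fun l => f l * g l).
Proof.
move=> [f0 [C fC]] [g0 [D gD]]; split=> [l|]; first by rewrite mulr_ge0.
by exists (C * D) => l; rewrite ler_pM.
Qed.

Lemma bounded_weight_cst (c : R) : 0 <= c -> bounded_weight (fun=> c).
Proof. by move=> c0; split=> //; exists c. Qed.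

Lemma bounded_weight_nat (b : S -> bool) : bounded_weight (fun l => (b l)%:R).
Proof. by split=> //; exists 1 => l; case: (b l); rewrite ?ler01 ?lexx. Qed.

Lemma bounded_weight_sum (n : nat) (f : nat -> S -> R) :
  (forall t, bounded_weight (f t)) ->
  bounded_weight (fun l => \sum_(t < n) f t l).
Proof.
move=> bf; elim: n => [|n ih].
  under eq_fun do rewrite big_ord0.
  exact: bounded_weight_cst.
under eq_fun do rewrite big_ord_recr/=.
exact: bounded_weightD.
Qed.

Lemma averageD f g q : bounded_weight f -> bounded_weight g ->
  average (fun l => f l + g l) q = average f q + average g q.
Proof.
move=> bf bg; apply: EFin_inj; rewrite EFinD !average_esum//; last first.
  exact: bounded_weightD.
rewrite -esumD => [|l _|l _].
- by apply: eq_esum => l _; rewrite mulrDr EFinD.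
- by rewrite lee_fin mulr_ge0//; [apply hp.1|apply bf.1].
- by rewrite lee_fin mulr_ge0//; [apply hp.1|apply bg.1].
Qed.

Lemma averageZr f c q : bounded_weight f -> 0 <= c ->
  average (fun l => f l * c) q = average f q * c.
Proof.
move=> bf c0; apply: EFin_inj; rewrite mulrC EFinM !average_esum//; last first.
  exact/bounded_weightM/bounded_weight_cst.
rewrite -esumZl// => [|l]; last first.
  by rewrite lee_fin mulr_ge0//; [apply hp.1|apply bf.1].
by apply: eq_esum => l _; rewrite -EFinM mulrA mulrC.
Qed.

Lemma average_cst c q : 0 <= c -> average (fun=> c) q = c.
Proof.
move=> c0; apply: EFin_inj; rewrite average_esum; last exact: bounded_weight_cst.
rewrite (eq_esum (b := fun l => (c%:E * (p q l)%:E)%E)) => [|l _]; last first.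
  by rewrite mulrC EFinM.
by rewrite esumZl// ?hp.2 ?mule1// => l; rewrite lee_fin; apply hp.1.
Qed.

Lemma average_sum (n : nat) (f : nat -> S -> R) q :
  (forall t, bounded_weight (f t)) ->
  average (fun l => \sum_(t < n) f t l) q = \sum_(t < n) average (f t) q.
Proof.
move=> bf; elim: n => [|n ih].
  under eq_fun do rewrite big_ord0.
  by rewrite big_ord0 average_cst.
under eq_fun do rewrite big_ord_recr/=.
by rewrite averageD ?ih ?big_ord_recr//; exact: bounded_weight_sum.
Qed.

Lemma average_le1 f q : bounded_weight f -> (forall l, f l <= 1) ->
  average f q <= 1.
Proof.
move=> bf f1; rewrite -lee_fin average_esum// -(hp.2 q); apply: le_esum => l _.
by rewrite lee_fin ler_piMr//; apply hp.1.
Qed.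

Lemma mpow_itv n j l : 0 <= mpow p n j l <= 1.
Proof.
elim: n j => [j|n ih j] /=; first by case: eqP; rewrite ?ler01 ?lexx.
have b : bounded_weight (fun m => mpow p n m l).
  by split=> [m|]; [|exists 1 => m]; case/andP: (ih m).
by rewrite average_ge0// average_le1// => m; case/andP: (ih m).
Qed.

Lemma bounded_weight_mpow n l : bounded_weight (fun j => mpow p n j l).
Proof.
by split=> [j|]; [|exists 1 => j]; case/andP: (mpow_itv n j l).
Qed.

(* The probability, started at [q], of avoiding [i] at the times [1, ..., n]. *)
Fixpoint avoid (i : S) (n : nat) (q : S) : R :=
  if n is n'.+1 then average (fun l => (l != i)%:R * avoid i n' l) q else 1.

Lemma avoid_itv i n q : 0 <= avoid i n q <= 1.
Proof.
elim: n q => [q|n ih q] /=; first by rewrite ler01 lexx.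
have b : bounded_weight (avoid i n).
  by split=> [m|]; [|exists 1 => m]; case/andP: (ih m).
rewrite average_ge0/= ?average_le1//=.
- by apply: bounded_weightM => //; exact: bounded_weight_nat.
- move=> l; case/andP: (ih l) => _; case: (l != i); first by rewrite mul1r.
  by rewrite mul0r ler01.
- by apply: bounded_weightM => //; exact: bounded_weight_nat.
Qed.

Lemma bounded_weight_avoid i n : bounded_weight (avoid i n).
Proof.
by split=> [j|]; [|exists 1 => j]; case/andP: (avoid_itv i n j).
Qed.

Lemma first_passage i n q :
  \sum_(s < n.+1) avoid i s q * mpow p (n - s) i i +
  \sum_(t < n.+1) mpow p t q i = \sum_(t < n.+1) mpow p t i i + (q == i)%:R.
Proof.
have m0 t : 0 <= mpow p t i i by case/andP: (mpow_itv t i i).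
elim: n q => [q|n ih q].
  by rewrite !big_ord_recr !big_ord0/= eqxx mulr1 !add0r.
(* [F] is constant. For [l != i] this is the induction hypothesis; for [l = i] the convolution
   vanishes and the other sum is already the constant. Its average over row [q] is therefore the
   same constant. *)
pose F l := \sum_(s < n.+1) (l != i)%:R * avoid i s l * mpow p (n - s) i i +
  \sum_(t < n.+1) mpow p t l i.
have bF1 : bounded_weight (fun l => \sum_(s < n.+1)
    (l != i)%:R * avoid i s l * mpow p (n - s) i i).
  apply: (@bounded_weight_sum _ (fun s l =>
    (l != i)%:R * avoid i s l * mpow p (n - s) i i)) => s.
  apply: bounded_weightM; last exact: bounded_weight_cst.
  by apply: bounded_weightM; [exact: bounded_weight_nat|
    exact: bounded_weight_avoid].
have bF2 : bounded_weight (fun l => \sum_(t < n.+1) mpow p t l i).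
  apply: (@bounded_weight_sum _ (fun t l => mpow p t l i)) => t.
  exact: bounded_weight_mpow.
have FE : F = (fun=> \sum_(t < n.+1) mpow p t i i).
  apply/funext => l; rewrite /F; have [->|li] := eqVneq l i.
    by rewrite big1 ?add0r// => s _; rewrite !mul0r.
  under eq_bigr do rewrite mul1r.
  by rewrite ih (negbTE li) addr0.
have : average F q = \sum_(t < n.+1) mpow p t i i.
  by rewrite FE average_cst// sumr_ge0.
rewrite /F {F FE} averageD//.
rewrite (average_sum _ (fun s l =>
    (l != i)%:R * avoid i s l * mpow p (n - s) i i)); last first.
  move=> s; apply: bounded_weightM; last exact: bounded_weight_cst.
  by apply: bounded_weightM; [exact: bounded_weight_nat|
    exact: bounded_weight_avoid].
rewrite (average_sum _ (fun t l => mpow p t l i)); last first.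
  by move=> t; exact: bounded_weight_mpow.
(* The averages in [E] are the terms of positive index at [n.+1]. The term [s = 0] is
   [mpow p n.+1 i i], which completes the sum on the right, and the term [t = 0] is
   [(q == i)%:R]. *)
move=> E; rewrite big_ord_recl/= mul1r.
rewrite [X in _ + X = _]big_ord_recl [in RHS]big_ord_recr/= -E.
rewrite addrACA -[RHS]addrA [RHS]addrC; congr (_ + (_ + _)).
apply: eq_bigr => s _; rewrite averageZr//.
by apply: bounded_weightM; [exact: bounded_weight_nat|
  exact: bounded_weight_avoid].
Qed.

End Average.

(** * Limits of convolutions of a nonnegative sequence with a convergent one *)

Section Convolution.
Context {R : realType} (u b : R^nat) (beta L : R).
Hypotheses (u0 : forall n, 0 <= u n) (b01 : forall n, 0 <= b n <= 1).
Hypothesis b_cvg : b @ \oo --> beta.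
Hypothesis L_cvg : (fun n => \sum_(s < n.+1) u s * b (n - s)%N) @ \oo --> L.

Lemma convolution_head_cvg M :
  (fun n => \sum_(0 <= s < M) u s * b (n - s)%N) @ \oo --> series u M * beta.
Proof.
elim: M => [|M ih].
  rewrite /series/= big_geq// mul0r.
  under eq_fun do rewrite big_geq//.
  exact: cvg_cst.
rewrite seriesSr mulrDl; under eq_fun do rewrite big_nat_recr//=.
apply: cvgD => //; apply: cvgM; first exact: cvg_cst.
by rewrite (cvg_centern M b).
Qed.

Lemma convolution_split M n : (M <= n)%N ->
  \sum_(s < n.+1) u s * b (n - s)%N =
  \sum_(0 <= s < M) u s * b (n - s)%N + \sum_(M <= s < n.+1) u s * b (n - s)%N.
Proof.
move=> Mn; rewrite -(big_mkord xpredT (fun s => u s * b (n - s)%N)).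
by rewrite (big_cat_nat (n := M))//= ltnW.
Qed.

(** Dropping the nonnegative terms [s >= M] leaves a finite head, whose limit is the left-hand
    side. *)
Lemma convolution_cvg_ge M : series u M * beta <= L.
Proof.
apply: (ler_cvg_to (convolution_head_cvg M) L_cvg).
near=> n; rewrite (convolution_split M n); last by near: n; exists M.
rewrite lerDl sumr_ge0// => s _; rewrite mulr_ge0//.
by case/andP: (b01 (n - s)).
Unshelve. all: by end_near. Qed.

(** Since [b <= 1], the terms [s >= M] add up to at most a tail of [series u], whose limit is
    [U - series u M]. *)
Lemma convolution_cvg_le M (U : R) : series u @ \oo --> U ->
  L <= series u M * beta + (U - series u M).
Proof.
move=> uU.
have H : (fun n => \sum_(0 <= s < M) u s * b (n - s)%N +
    (series u (n + 1)%N - series u M)) @ \oo -->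
    series u M * beta + (U - series u M).
  apply: cvgD; first exact: convolution_head_cvg.
  by apply: cvgB; [rewrite (cvg_shiftn 1 (series u) (nbhs U))|exact: cvg_cst].
apply: (ler_cvg_to L_cvg H).
near=> n; have Mn : (M <= n)%N by near: n; exists M.
rewrite (convolution_split M n)// lerD2l addn1 sub_series_geq 1?ltnW//.
apply: ler_sum => s _; rewrite ler_piMr//.
by case/andP: (b01 (n - s)).
Unshelve. all: by end_near. Qed.

(** Both bounds tend to [U * beta] as [M] grows. *)
Lemma convolution_cvgE (U : R) : series u @ \oo --> U -> U * beta = L.
Proof.
move=> uU; apply/eqP; rewrite eq_le; apply/andP; split.
  apply: (ler_cvg_to (cvgM uU (cvg_cst beta)) (cvg_cst L)).
  by apply: nearW => M; exact: convolution_cvg_ge.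
have H : (fun M => series u M * beta + (U - series u M)) @ \oo --> U * beta.
  rewrite -[X in _ --> X]addr0 -(subrr U).
  apply: cvgD; first by apply: cvgM => //; exact: cvg_cst.
  by apply: cvgB => //; exact: cvg_cst.
apply: (ler_cvg_to (cvg_cst L) H).
by apply: nearW => M; exact: convolution_cvg_le.
Qed.

(** The lower bound keeps the partial sums below [L / beta]. This is what makes the expected hitting
    times of [i] from other states finite. *)
Lemma convolution_summable : 0 < beta -> cvgn (series u).
Proof.
move=> beta0; apply: nondecreasing_is_cvgn.
  by apply: nondecreasing_series.
exists (L / beta) => _ [M _ <-]; rewrite ler_pdivlMr//.
exact: convolution_cvg_ge.
Qed.

End Convolution.

(** * Expected hitting times in terms of the fundamental matrix *)

Section FundamentalMatrix.
Context {R : realType} {S : countType} (p : S -> S -> R) (pi : S -> R) (i : S).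
Hypothesis hp : stochastic p.
Hypothesis hZ : forall j, cvgn (fundamental_series p pi j i).

Let avoid0 q n : 0 <= avoid p i n q.
Proof. by case/andP: (avoid_itv _ hp i n q). Qed.

(** The general term of the convergent series for [Z_ii] tends to 0. *)
Lemma mpow_cvg : (fun t => mpow p t i i) @ \oo --> pi i.
Proof.
have /cvg_series_cvg_0 := hZ i.
move=> /(cvgD (cvg_cst (pi i))); rewrite addr0; apply: cvg_trans.
by apply: near_eq_cvg; apply: nearW => t /=; rewrite addrC subrK.
Qed.

Lemma mpow_limit_ge0 : 0 <= pi i.
Proof.
apply: (ler_cvg_to (cvg_cst 0) mpow_cvg); apply: nearW => n.
by case/andP: (mpow_itv _ hp n i i).
Qed.

(** In the difference of the partial sums for [Z_ii] and [Z_qi] the constants [pi i] cancel, and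
    [first_passage] identifies what is left. *)
Lemma avoid_convolution_cvg q :
  (fun n => \sum_(s < n.+1) avoid p i s q * mpow p (n - s) i i) @ \oo -->
  fundamental_mx p pi i i - fundamental_mx p pi q i + (q == i)%:R.
Proof.
(* [series] at [n + 1] covers the times 0 to [n], hence the shift. *)
have FS j : (fun n => fundamental_series p pi j i (n + 1)%N) @ \oo -->
    fundamental_mx p pi j i.
  by rewrite (cvg_shiftn 1 (fundamental_series p pi j i)
    (nbhs (fundamental_mx p pi j i))); exact: hZ.
rewrite [X in X @ _ --> _](_ : _ = fun n => fundamental_series p pi i i (n + 1)%N -
    fundamental_series p pi q i (n + 1)%N + (q == i)%:R).
  by apply: cvgD; [apply: cvgB; exact: FS|exact: cvg_cst].
apply/funext => n.
rewrite /fundamental_series /series/= addn1 !sumrB opprB subrKA.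
by rewrite !big_mkord addrAC -first_passage// addrK.
Qed.

(** The case [q = i], where the entries of [Z] cancel: Kac's formula in terms of [avoid]. *)
Lemma limit_mpow_mean_avoid : cvgn (series (fun n => avoid p i n i)) ->
  limn (series (fun n => avoid p i n i)) * pi i = 1.
Proof.
move=> cv; have := avoid_convolution_cvg i.
rewrite subrr eqxx add0r => H.
apply: (convolution_cvgE _ _ _ _ (avoid0 i) _ mpow_cvg H _ cv).
by move=> n; exact: mpow_itv.
Qed.

Lemma fundamental_mxB q : cvgn (series (fun n => avoid p i n i)) -> q != i ->
  cvgn (series (fun n => avoid p i n q)) /\
  limn (series (fun n => avoid p i n q)) * pi i =
    fundamental_mx p pi i i - fundamental_mx p pi q i.
Proof.
move=> cv qi; have := avoid_convolution_cvg q; rewrite (negbTE qi) addr0 => H.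
have b01 n : 0 <= mpow p n i i <= 1 by exact: mpow_itv.
have E := limit_mpow_mean_avoid cv.
(* Positivity comes from Kac's formula, whose product would otherwise be 0. *)
have pi0 : 0 < pi i.
  rewrite lt_neqAle mpow_limit_ge0 andbT; apply/eqP => pi0.
  by move: E; rewrite -pi0 mulr0 => /esym/eqP; rewrite oner_eq0.
have cvq : cvgn (series (fun n => avoid p i n q)).
  exact: (convolution_summable _ _ _ _ (avoid0 q) b01 mpow_cvg H pi0).
split=> //; exact: (convolution_cvgE _ _ _ _ (avoid0 q) b01 mpow_cvg H _ cvq).
Qed.

End FundamentalMatrix.

(** * Events of the past, the Markov property and survival probabilities *)

Section MarkovChain.
Context {d : measure_display} {Omega : measurableType d} {R : realType}.
Context {S : countType}.
Implicit Types (P : probability Omega R) (E : set Omega).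

Lemma bigcup_fibers (T : countType) (f : Omega -> T) E :
  E = \bigcup_n (E `&` [set w | pickle (f w) = n]).
Proof.
apply/seteqP; split=> w; last by move=> [n _ []].
by move=> Ew; exists (pickle (f w)).
Qed.

Lemma pickle_fiber (T : countType) (f : Omega -> T) n :
  (exists x, [set w | pickle (f w) = n] = f @^-1` [set x]) \/
  [set w | pickle (f w) = n] = set0.
Proof.
have [[x <-]|nx] := pselect (exists x : T, pickle x = n); [left|right].
  by exists x; apply/seteqP; split=> w /= => [/(pcan_inj pickleK)|->].
by rewrite -subset0 => w /= fw; apply: nx; exists (f w).
Qed.

Lemma measurable_fibers (T : countType) (f : Omega -> T) E :
  (forall x, measurable (E `&` f @^-1` [set x])) -> measurable E.
Proof.
move=> mE; rewrite (bigcup_fibers _ f E); apply: bigcup_measurable => n _.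
by have [[x ->]|->] := pickle_fiber _ f n; rewrite ?setI0.
Qed.

Lemma measure_fibers (T : countType) P (f : Omega -> T) E : measurable E ->
  (forall x, measurable (f @^-1` [set x])) ->
  P E = (\esum_(x in [set: T]) P (E `&` f @^-1` [set x]))%E.
Proof.
move=> mE mf.
have mn n : measurable (E `&` [set w | pickle (f w) = n]).
  by apply: measurableI => //; have [[x ->]|->] := pickle_fiber _ f n.
rewrite [in LHS](bigcup_fibers _ f E) measure_semi_bigcup//; last first.
- exact: bigcup_measurable.
- by move=> m n _ _ [w [[_ <-] [_ <-]]].
rewrite nneseries_esumT//.
transitivity (\esum_(n in pickle @` [set: T])
  P (E `&` [set w | pickle (f w) = n]))%E.
  rewrite [RHS]esum_mkcond; apply: eq_esum => n _; case: ifPn => // /negP nx.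
  rewrite (_ : _ `&` _ = set0) ?measure0// -subset0 => w [_ /= fw]; apply: nx.
  by rewrite inE; exists (f w).
rewrite esum_image; last by move=> x y _ _; apply: (pcan_inj pickleK).
apply: eq_esum => x _; congr (P (E `&` _)).
by apply/seteqP; split=> w /= => [/(pcan_inj pickleK)|->].
Qed.

Variables (P : probability Omega R) (X : nat -> Omega -> S) (p : S -> S -> R).
Hypothesis hp : stochastic p.
Hypothesis hX : markov_chain P X p.

(** The path up to time [n] as a sequence: [seq S] is countable, so its fibers, the histories, form
    a countable partition. *)
Let past n w := mkseq (X ^~ w) n.+1.

Let pastE n w : past n @^-1` [set past n w] = history X n (X ^~ w).
Proof.
apply/seteqP; split=> w' /=.
  move=> e t tn; have := congr1 (fun s => nth (X t w) s t) e.
  by rewrite /past !nth_mkseq.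
move=> h; rewrite /past /mkseq; apply/eq_in_map => t.
by rewrite mem_iota add0n ltnS => /andP[_]; exact: h.
Qed.

Lemma measurable_history n x : measurable (history X n x).
Proof.
rewrite (_ : history X n x =
    \bigcap_(t in [set t | (t <= n)%N]) (X t @^-1` [set x t])).
  by apply: bigcap_measurable => [|t _]; [exists 0%N|exact: hX.1].
by apply/seteqP; split=> w h t; exact: h.
Qed.

Lemma measurable_past_fiber n x : measurable (past n @^-1` [set x]).
Proof.
have [[w <-]|nw] := pselect (exists w, past n w = x).
  by rewrite pastE; exact: measurable_history.
by rewrite (_ : _ @^-1` _ = set0)// -subset0 => w /= e; apply: nw; exists w.
Qed.

(** The events determined by [X 0, ..., X n]. Each is a countable union of histories, which gives
    its measurability and lets the Markov property be summed over it. *)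
Definition past_event n E : Prop :=
  forall w w', (forall t, (t <= n)%N -> X t w' = X t w) -> E w -> E w'.

Lemma past_event_fiber n E x : past_event n E ->
  E `&` past n @^-1` [set x] = set0 \/
  exists2 w, E w & E `&` past n @^-1` [set x] = history X n (X ^~ w).
Proof.
move=> hE.
have [->|/set0P[w [Ew /= <-]]] := eqVneq (E `&` past n @^-1` [set x]) set0.
  by left.
right; exists w => //; rewrite pastE; apply/seteqP; split=> [w' []//|w' h].
by split=> //; apply: hE Ew.
Qed.

Lemma measurable_past_event n E : past_event n E -> measurable E.
Proof.
move=> hE; apply: (@measurable_fibers _ (past n)) => x.
have [->//|[w _ ->]] := past_event_fiber n E x hE.
exact: measurable_history.
Qed.

Lemma markov_history n w l :
  P (history X n (X ^~ w) `&` X n.+1 @^-1` [set l]) =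
  (P (history X n (X ^~ w)) * (p (X n w) l)%:E)%E.
Proof.
(* [markov_chain] reads the next state off the path as well, so the path of [w] is continued by
   [l]. *)
pose x t := if (t <= n)%N then X t w else l.
have -> : history X n (X ^~ w) = history X n x.
  by apply/seteqP; split=> w' h t tn; have := h t tn; rewrite /x tn.
have mh := measurable_history n x.
have mX := hX.1 n.+1 l.
(* A null history carries no transition condition, but then both sides vanish by monotonicity. *)
have [h0|h0] := eqVneq (P (history X n x)) 0%E.
  rewrite h0 mul0e; apply/eqP; rewrite eq_le measure_ge0 andbT -h0.
  by apply: le_measure; rewrite ?inE//; exact: measurableI.
have hgt : (0 < P (history X n x))%E by rewrite lt0e h0 measure_ge0.
have := hX.2 n x hgt; rewrite /cond_prob.
have -> : x n.+1 = l by rewrite /x ltnn.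
have -> : x n = X n w by rewrite /x leqnn.
have hf : P (history X n x) \is a fin_num by exact: fin_num_measure.
have fgt : fine (P (history X n x)) != 0 by rewrite fine_eq0.
move=> <-; rewrite -[X in (X * _)%E](fineK hf) -EFinM mulrC divfK//.
by rewrite setIC fineK// fin_num_measure//; exact: measurableI.
Qed.

(** Sum of [markov_history] over the histories that make up [E], all of which end at [m]. *)
Lemma markov_step n m l E : past_event n E -> E `<=` X n @^-1` [set m] ->
  P (E `&` X n.+1 @^-1` [set l]) = (P E * (p m l)%:E)%E.
Proof.
move=> hE Em; have mE := measurable_past_event n E hE.
have mf := measurable_past_fiber n.
have p0 : 0 <= p m l by apply hp.1.
rewrite (@measure_fibers _ P (past n) E)// muleC -esumZl//.
rewrite (@measure_fibers _ P (past n))//; last first.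
  by apply: measurableI => //; exact: hX.1.
apply: eq_esum => x _; rewrite setIAC.
have [->|[w Ew ->]] := past_event_fiber n E x hE.
  by rewrite set0I measure0 mule0.
by rewrite markov_history (Em _ Ew) muleC.
Qed.

Lemma survivalE i n :
  survival R X i n = [set w | forall t, (0 < t <= n)%N -> X t w != i].
Proof.
apply/seteqP; split=> w; rewrite /survival/=.
  move=> lt t /andP[t0 tn]; apply/negP => /eqP Xt.
  have : (return_time X i w <= t%:R%:E :> \bar R)%E.
    by apply: ereal_inf_lbound; exists t.
  move/(lt_le_trans lt); rewrite lte_fin ltr_nat ltnNge tn.
  by [].
(* All visits to [i] at positive times occur at [n.+1] or later, so the infimum, possibly [+oo], is
   at least [n.+1]. *)
move=> h; apply: (@lt_le_trans _ _ n.+1%:R%:E); first by rewrite lte_fin ltr_nat.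
apply: le_ereal_inf_tmp => _ [t [t0 Xt] <-]; rewrite lee_fin ler_nat ltnNge.
by apply/negP => tn; have := h t; rewrite t0 tn => /(_ isT); rewrite Xt eqxx.
Qed.

Lemma survival_past i n : past_event n (survival R X i n).
Proof.
rewrite survivalE => w w' h Ew t /[dup] /andP[_ tn] tn'.
by rewrite h//; exact: Ew.
Qed.

Lemma survival_at_past i n m :
  past_event n (survival R X i n `&` X n @^-1` [set m]).
Proof.
by move=> w w' h [/(survival_past _ _ _ _ h) sw' /=]; rewrite -h.
Qed.

Lemma measurable_survival i n : measurable (survival R X i n).
Proof. exact/measurable_past_event/survival_past. Qed.

Lemma survivalS i n l : l != i ->
  survival R X i n.+1 `&` X n.+1 @^-1` [set l] =
  survival R X i n `&` X n.+1 @^-1` [set l].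
Proof.
move=> li; rewrite !survivalE; apply/seteqP; split=> w [/= sw Xl]; split=> //.
  by move=> t /andP[t0 tn]; apply: sw; rewrite t0 ltnW.
move=> t /andP[t0]; rewrite leq_eqVlt ltnS => /orP[/eqP ->|tn].
  by rewrite Xl.
by apply: sw; rewrite t0.
Qed.

(** The taboo probabilities with taboo state [i]. *)
Definition survival_at i n m : R :=
  fine (P (survival R X i n `&` X n @^-1` [set m])).

Lemma survival_atE i n m :
  (survival_at i n m)%:E = P (survival R X i n `&` X n @^-1` [set m]).
Proof.
rewrite fineK// fin_num_measure//.
by apply: measurableI; [exact: measurable_survival|exact: hX.1].
Qed.

Lemma survival_at_ge0 i n m : 0 <= survival_at i n m.
Proof. exact/fine_ge0/measure_ge0. Qed.

Lemma survival_at_self i n : survival_at i n.+1 i = 0.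
Proof.
rewrite /survival_at (_ : _ `&` _ = set0) ?measure0// -subset0 survivalE.
by move=> w [/= /(_ n.+1)]; rewrite ltn0Sn leqnn => /(_ isT) /eqP.
Qed.

Lemma survival_atS i n l : l != i ->
  (survival_at i n.+1 l)%:E =
  (\esum_(m in [set: S]) (survival_at i n m * p m l)%:E)%E.
Proof.
move=> li; rewrite survival_atE survivalS//.
rewrite (@measure_fibers _ P (X n))//; last 2 first.
- by apply: measurableI; [exact: measurable_survival|exact: hX.1].
- by move=> x; exact: hX.1.
apply: eq_esum => m _; rewrite setIAC (@markov_step n m)//.
- by rewrite EFinM survival_atE.
- exact: survival_at_past.
Qed.

(** The Markov property at time [n]. By induction on [h], exchanging two sums moves one step from
    [avoid] to [survival_at]. *)
Lemma survival_avoid i n h :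
  (\esum_(m in [set: S]) (survival_at i n m * avoid p i h m)%:E)%E =
  P (survival R X i (n + h)).
Proof.
elim: h n => [|h ih] n.
  rewrite addn0 (@measure_fibers _ P (X n))//; last 2 first.
  - exact: measurable_survival.
  - by move=> x; exact: hX.1.
  by apply: eq_esum => m _; rewrite /= mulr1 survival_atE.
rewrite addnS -addSn -ih.
under eq_esum => m _.
  rewrite EFinM /= average_esum//; last first.
    by apply: bounded_weightM; [exact: bounded_weight_nat|
      exact: bounded_weight_avoid].
  rewrite -esumZl ?survival_at_ge0//; last first.
    move=> l; rewrite lee_fin mulr_ge0//; first by apply hp.1.
    by rewrite mulr_ge0//; case/andP: (avoid_itv p hp i h l).
  over.
rewrite esum_exchange; last first.
  move=> m l; rewrite -EFinM lee_fin mulr_ge0 ?survival_at_ge0// mulr_ge0//.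
    by apply hp.1.
  by rewrite mulr_ge0//; case/andP: (avoid_itv p hp i h l).
(* At [l = i] the left side vanishes by the indicator in [avoid], the right side by
   [survival_at_self]. *)
apply: eq_esum => l _; have [->|li] := eqVneq l i.
  by rewrite survival_at_self mul0r esum1// => m _; rewrite mulr0 mule0.
rewrite [in RHS]mulrC EFinM survival_atS// -esumZl//; last 2 first.
- by case/andP: (avoid_itv p hp i h l).
- by move=> m; rewrite lee_fin mulr_ge0 ?survival_at_ge0//; apply hp.1.
by apply: eq_esum => m _; rewrite /= mul1r -!EFinM mulrA mulrC.
Qed.

(** The case of time 0 in [survival_avoid]: survival up to 0 is certain, so [survival_at] is the
    point mass at [i]. *)
Lemma survival_start i n : P (X 0%N @^-1` [set i]) = 1%E ->
  P (survival R X i n) = (avoid p i n i)%:E.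
Proof.
move=> h0; rewrite -[n in LHS]add0n -survival_avoid.
have P0 m : survival_at i 0 m = (m == i)%:R.
  rewrite /survival_at survivalE.
  rewrite (_ : [set w | _] = setT) ?setTI; last first.
    by rewrite -subTset => w _ t /andP[]; case: t.
  have [->|mi] := eqVneq m i; first by rewrite h0.
  have : (P (X 0%N @^-1` [set m]) <= P (~` (X 0%N @^-1` [set i])))%E.
    apply: le_measure; rewrite ?inE; [exact: hX.1|exact/measurableC/hX.1|].
    by move=> w /= -> /eqP; exact/negP.
  rewrite probability_setC; last exact: hX.1.
  by rewrite h0 subee// measure_le0 => /eqP ->.
rewrite -[RHS](@esum_set1 _ _ i (fun m => (avoid p i n m)%:E)); last first.
  by rewrite lee_fin; case/andP: (avoid_itv p hp i n i).
rewrite [RHS]esum_mkcond; apply: eq_esum => m _; rewrite P0.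
have [->|mi] := eqVneq m i; first by rewrite mem_set// mul1r.
by rewrite memNset ?mul0r//=; exact/eqP.
Qed.

Lemma return_timeP i w :
  return_time X i w = +oo%E :> \bar R \/
  exists2 t, (0 < t)%N & return_time X i w = t%:R%:E :> \bar R.
Proof.
have [[t0 Xt0]|nX] := pselect (exists t, (0 < t)%N && (X t w == i)); last first.
  left; rewrite /return_time (_ : [set t | _] = set0) ?image_set0 ?ereal_inf0//.
  by rewrite -subset0 => t [t0 Xt]; apply: nX; exists t; rewrite t0 Xt eqxx.
have ex : exists t, (0 < t)%N && (X t w == i) by exists t0.
right; case: (ex_minnP ex) => t /andP[t_gt0 /eqP Xt] tmin; exists t => //.
apply/eqP; rewrite eq_le; apply/andP; split.
  by apply: ereal_inf_lbound; exists t.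
apply: le_ereal_inf_tmp => _ [s [s0 Xs] <-]; rewrite lee_fin ler_nat.
by apply: tmin; rewrite s0 Xs eqxx.
Qed.

(** Layer-cake formula: an integer-valued time counts the [n] that it exceeds. *)
Lemma truncated_return_time_sum i theta w :
  truncated_return_time X i theta w =
  \sum_(n < theta) \1_(survival R X i n) w :> R.
Proof.
rewrite /truncated_return_time; have [T|[t t0 T]] := return_timeP i w; rewrite T.
  rewrite (eq_bigr (fun=> 1)) => [|n _].
    by rewrite sumr_const card_ord min_r ?leey.
  by rewrite indicE mem_set// /survival/= T ltry.
rewrite (eq_bigr (fun n : 'I_theta => (n < t)%N%:R)) => [|n _].
  by rewrite sum_ltn_natr -EFin_min/= -(@natr_min R) minnC.
rewrite indicE; congr (nat_of_bool _)%:R.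
by apply/idP/idP; rewrite inE /survival/= T lte_fin ltr_nat.
Qed.

Lemma return_time_sum i w :
  return_time X i w = (\sum_(n <oo) (\1_(survival R X i n) w)%:E)%E :> \bar R.
Proof.

have [T|[t t0 T]] := return_timeP i w; rewrite T; apply/esym/cvg_lim => //.
  rewrite (_ : (fun k => _) = fun k : nat => (k%:R : R)%:E); last first.
    apply/funext => k; rewrite (eq_bigr (fun=> 1%E)) => [|n _].
      by rewrite sumEFin sumr_const_nat subn0.
    by rewrite indicE mem_set// /survival/= T ltry.
  exact/cvgenyP/cvg_id.
apply: cvg_near_cst; exists t => // k /= tk.
rewrite big_mkord (eq_bigr (fun n : 'I_k => ((n < t)%N%:R : R)%:E)) => [|n _].
  by rewrite sumEFin sum_ltn_natr (minn_idPr tk).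
congr EFin; rewrite indicE; congr (nat_of_bool _)%:R.
by apply/idP/idP; rewrite inE /survival/= T lte_fin ltr_nat.
Qed.

(** Tail-sum formula, by termwise integration of the layer-cake series. *)
Lemma mean_return_time_sum i :
  mean_return_time P X i = (\sum_(n <oo) P (survival R X i n))%E.
Proof.
rewrite /mean_return_time.
under eq_integral do rewrite return_time_sum.
rewrite integral_nneseries//.

- apply: eq_eseriesr => n _; rewrite integral_indic ?setIT//.
  exact: measurable_survival.
- by move=> n; apply/measurable_EFinP/measurable_indic; exact: measurable_survival.
Qed.

Lemma truncated_return_timeP i theta w :
  exists m : nat, [/\ (m <= theta)%N, truncated_return_time X i theta w = m%:R :> R &
    forall n, (n < theta)%N -> survival R X i n w <-> (n < m)%N].
Proof.
rewrite truncated_return_time_sum; have [T|[t t0 T]] := return_timeP i w.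
  exists theta; split=> // [|n nt]; last by rewrite /survival/= T nt ltry.
  rewrite (eq_bigr (fun=> 1)) => [|n _]; first by rewrite sumr_const card_ord.
  by rewrite indicE mem_set// /survival/= T ltry.
have sE n : survival R X i n w <-> (n < t)%N.
  by rewrite /survival/= T lte_fin ltr_nat.
exists (minn theta t); split=> [||n nt]; first exact: geq_minl.
  rewrite -sum_ltn_natr; apply: eq_bigr => n _.
  by rewrite indicE; congr (nat_of_bool _)%:R; apply/idP/idP; rewrite inE => /sE.
by rewrite sE leq_min nt.
Qed.

(** Independent copies share only the law of the truncated time, so survival has to be written as
    the preimage of a Borel set. *)
Lemma truncated_return_time_gt i theta n : (n < theta)%N ->
  truncated_return_time X i theta @^-1` [set x : R | n%:R < x] = survival R X i n.
Proof.
move=> nt; apply/seteqP; split=> w /=;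
  have [m [_ -> /(_ n nt) H]] := truncated_return_timeP i theta w.
  by rewrite ltr_nat => /H.
by move=> /H; rewrite ltr_nat.
Qed.

Lemma truncated_return_time_nat i theta :
  truncated_return_time X i theta @^-1`
    [set x : R | exists2 m, (m <= theta)%N & x = m%:R] = setT.
Proof.
rewrite -subTset => w _ /=.
by have [m [mt -> _]] := truncated_return_timeP i theta w; exists m.
Qed.

End MarkovChain.

(** * Expectation of a sample average with a random number of copies *)

Section SampleAverage.
Context {d d' : measure_display} {Omega : measurableType d}
  {Omega' : measurableType d'} {R : realType}.
Variables (P : probability Omega R) (V : Omega -> R) (Q : probability Omega' R).
Variables (N : {RV Q >-> nat}) (Y : nat -> {RV Q >-> R}) (theta : nat).
Hypothesis hY : independent_copies P V N Y.
Hypothesis V_nat :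
  P (V @^-1` [set x | exists2 m, (m <= theta)%N & x = m%:R]) = 1%E.

Let N_gt0 w : (0 < N w)%N. Proof. by case: hY. Qed.

Let measurable_N m : measurable (N @^-1` [set m]).
Proof. exact: measurable_funPTI. Qed.

Let measurable_gt (n : nat) : measurable [set x : R | n%:R < x].
Proof. by rewrite -set_itvoy; exact: measurable_itv. Qed.

Let measurable_Ygt s (n : nat) : measurable (Y s @^-1` [set x : R | n%:R < x]).
Proof. exact: measurable_funPTI. Qed.

Lemma measurable_random_index (g : nat -> Omega' -> R) :
  (forall m, measurable_fun setT (g m)) ->
  measurable_fun setT (fun w => g (N w) w).
Proof.
move=> mg; rewrite (_ : setT = \bigcup_m (N @^-1` [set m])); last first.
  by apply/seteqP; split=> w // _; exists (N w).
apply/measurable_fun_bigcup => // m.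
apply: (@eq_measurable_fun _ _ _ _ _ (g m)); first by move=> w; rewrite inE/= => ->.
exact: measurable_funS (mg m).
Qed.

(** The product rule with [setT] imposed on all copies before [s], whose factors are 1. *)
Lemma independent_copy_event s m (B : set R) : measurable B ->
  Q (N @^-1` [set m] `&` Y s @^-1` B) = (Q (N @^-1` [set m]) * P (V @^-1` B))%E.
Proof.
move=> mB; case: hY => _ hV hI.
have := hI [set m] s.+1 (fun t => if t == s then B else setT).
have -> : \bigcap_(t < s.+1) Y t @^-1` (if t == s then B else setT) = Y s @^-1` B.
  apply/seteqP; split=> w /=; first by move/(_ s (ltnSn s)); rewrite eqxx.
  by move=> h t _; case: eqP => // ->.
move=> -> => [|t]; last by case: eqP.
rewrite big_ord_recr/= eqxx big1 ?mul1e ?hV// => t _.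
by rewrite (ltn_eqF (ltn_ord t)) preimage_setT probability_setT.
Qed.

Lemma ae_copy_nat : {ae Q, forall w s, exists2 m, (m <= theta)%N & Y s w = m%:R}.
Proof.
apply: ae_foralln => s.
pose B : set R := [set x | exists2 m, (m <= theta)%N & x = m%:R].
have mB : measurable B.
  rewrite (_ : B = \bigcup_(m in [set m | (m <= theta)%N]) [set m%:R]).
    by apply: bigcup_measurable => m _; exact: measurable_set1.
  by apply/seteqP; split=> [x [m mt ->]|x [m mt ->]]; exists m.
have mYB : measurable (Y s @^-1` B) by exact: measurable_funPTI.
have Q0 : Q (~` (Y s @^-1` B)) = 0%E.
  by rewrite probability_setC//; case: hY => _ -> // _; rewrite V_nat subee.
by exists (~` (Y s @^-1` B)); split => //; exact: measurableC.
Qed.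

(** Layer-cake form of the average of [m] copies. It is nonnegative everywhere, whereas the copies
    are natural numbers only almost everywhere. *)
Let level m w : R :=
  (\sum_(s < m) \sum_(n < theta) \1_(Y s @^-1` [set x | n%:R < x]) w) / m%:R.

Let level_ge0 m w : 0 <= level m w.
Proof. by rewrite divr_ge0// sumr_ge0// => s _; rewrite sumr_ge0. Qed.

Let measurable_level m : measurable_fun setT (level m).
Proof.
apply: measurable_funM; last exact: measurable_cst.
apply: measurable_sum => s; apply: measurable_sum => n.
exact/measurable_indic/measurable_Ygt.
Qed.

Lemma expectation_sample_average :
  ('E_Q[sample_average N Y] =
   \sum_(n < theta) P (V @^-1` [set x | n%:R < x]%R))%E.
Proof.
have mavg : measurable_fun setT (sample_average N Y).
  apply: (measurable_random_index (fun m w => (\sum_(s < m) Y s w) / m%:R)) => m.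
  apply: measurable_funM; last exact: measurable_cst.
  by apply: measurable_sum => s; exact: measurable_funPT.
have mlev := measurable_random_index _ measurable_level.
rewrite unlock (@ae_eq_integral _ _ _ _ _
  (fun w => (level (N w) w)%:E))//; last 3 first.
- exact/measurable_EFinP.
- exact/measurable_EFinP.
- apply: filterS ae_copy_nat => w h _ /=; congr EFin; congr (_ / _).
  apply: eq_bigr => s _; have [m mt Ym] := h s; rewrite Ym.
  rewrite (eq_bigr (fun n : 'I_theta => (n < m)%N%:R)) => [|n _].
    by rewrite sum_ltn_natr (minn_idPr mt).
  rewrite indicE; congr (nat_of_bool _)%:R.
  by apply/idP/idP; rewrite inE/= Ym ltr_nat.
have TE : setT = \bigcup_m (N @^-1` [set m]).
  by apply/seteqP; split=> w // _; exists (N w).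
(* The integral is split according to the value of [N]; on each piece the number of copies is
   fixed. *)
rewrite {1}TE ge0_integral_bigcup//; last 3 first.
- by rewrite -TE; exact/measurable_EFinP.
- by move=> w _; rewrite lee_fin.
- by move=> m m' _ _ [w [<- <-]].
set c := (\sum_(n < theta) _)%E.
have c_fin : c \is a fin_num.
  apply/sum_fin_numP => n _ _; case: hY => _ hV _.
  by rewrite -(hV 0%N)// fin_num_measure.
(* By independence the piece [N = m] contributes [c] times its probability, and these probabilities
   add up to 1. *)
transitivity (\sum_(0 <= m <oo) (Q (N @^-1` [set m]) * c))%E; last first.
  rewrite (eq_eseriesr
    (g := fun m => (fine c)%:E * Q (N @^-1` [set m])))%E; last first.
    by move=> m _; rewrite muleC fineK.
  rewrite nneseriesZl// -measure_semi_bigcup//; last 2 first.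
  - by move=> m m' _ _ [w [<- <-]].
  - exact: bigcup_measurable.
  rewrite -TE -[RHS]fineK// -[RHS]mule1; congr (_ * _)%E.
  exact: probability_setT.
apply: eq_eseriesr => m _.
(* [N] is positive, so the piece [m = 0], where the division is degenerate, is empty. *)
have [->|m0] := posnP m.
  rewrite (_ : _ @^-1` _ = set0) ?integral_set0 ?measure0 ?mul0e//.
  by rewrite -subset0 => w /= Nw; have := N_gt0 w; rewrite Nw.
rewrite (eq_integral (fun w => (m%:R^-1)%:E * \sum_(s < m) \sum_(n < theta)
    (\1_(Y s @^-1` [set x | n%:R < x]%R) w)%:E)%E); last first.
  move=> w; rewrite inE/= => ->; rewrite /level mulrC EFinM -sumEFin.
  by congr (_ * _)%E; apply: eq_bigr => s _; rewrite sumEFin.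
have mI s n : measurable_fun (N @^-1` [set m])
    (fun w => (\1_(Y s @^-1` [set x : R | n%:R < x]) w : R)%:E).
  exact/measurable_EFinP/measurable_indic.
rewrite ge0_integralZl//; last 2 first.
- by apply: emeasurable_sum => s; apply: emeasurable_sum => n.
- by move=> w _; rewrite sume_ge0// => s _; rewrite sume_ge0.
rewrite ge0_integral_sum//; last 2 first.
- by move=> s; apply: emeasurable_sum => n.
- by move=> s w _; rewrite sume_ge0.
have QcE : (Q (N @^-1` [set m]) * c)%E \is a fin_num.
  by rewrite fin_numM// fin_num_measure.
(* The [m] copies contribute equally, which cancels the factor [m%:R^-1]. *)
rewrite (eq_bigr (fun=> (fine (Q (N @^-1` [set m]) * c))%:E)) => [|s _].
  rewrite sumEFin sumr_const card_ord -EFinM -[X in _ * X]mulr_natl mulrA.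
  by rewrite mulVf ?mul1r ?fineK// pnatr_eq0 -lt0n.
rewrite fineK// ge0_integral_sum//.
rewrite /c ge0_sume_distrr//; apply: eq_bigr => n _.
by rewrite integral_indic// setIC; exact: independent_copy_event.
Qed.

End SampleAverage.

(** * Real series viewed in the extended reals *)

Lemma nneseries_EFin_cvg (R : realType) (u : R^nat) : (forall n, 0 <= u n) ->
  (\sum_(n <oo) (u n)%:E < +oo)%E -> cvgn (series u).
Proof.
move=> u0 uoo; have eu0 n : (0 <= (u n)%:E)%E by rewrite lee_fin.
have su0 : (0 <= \sum_(n <oo) (u n)%:E)%E by apply: nneseries_ge0.
apply: nondecreasing_is_cvgn; first by apply: nondecreasing_series.
exists (fine (\sum_(n <oo) (u n)%:E)%E) => _ [M _ <-].
rewrite -lee_fin fineK ?ge0_fin_numE// /series/= -sumEFin.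
by apply: nneseries_lim_ge.
Qed.

Lemma nneseries_EFin (R : realType) (u : R^nat) : cvgn (series u) ->
  (\sum_(n <oo) (u n)%:E = (limn (series u))%:E)%E.
Proof.
by move=> cu; rewrite -EFin_lim//; congr (limn _); apply/funext => n /=;
  rewrite sumEFin.
Qed.

(** * The expected excess of the return time over the threshold *)

Section Excess.
Context {d : measure_display} {Omega : measurableType d} {R : realType}.
Context {S : countType} (P : probability Omega R) (X : nat -> Omega -> S).
Variables (p : S -> S -> R) (pi : S -> R) (i : S).
Hypothesis hp : stochastic p.
Hypothesis hX : markov_chain P X p.
Hypothesis h0 : P (X 0%N @^-1` [set i]) = 1%E.
Hypothesis hrec : (mean_return_time P X i < +oo)%E.
Hypothesis hZ : forall j, cvgn (fundamental_series p pi j i).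

Let u n := avoid p i n i.
Let avoid0 n q : 0 <= avoid p i n q.
Proof. by case/andP: (avoid_itv p hp i n q). Qed.

Let survE n : P (survival R X i n) = (u n)%:E.
Proof. exact: survival_start h0. Qed.

Let u_series : mean_return_time P X i = (\sum_(n <oo) (u n)%:E)%E.
Proof.
rewrite (mean_return_time_sum _ _ _ hX).
by apply: eq_eseriesr => n _; exact: survE.
Qed.

Lemma avoid_self_cvg : cvgn (series u).
Proof.
apply: nneseries_EFin_cvg => [n|]; first exact: avoid0.
by move: hrec; rewrite u_series.
Qed.

Lemma mean_return_timeE : mean_return_time P X i = (limn (series u))%:E.
Proof. by rewrite u_series; apply: nneseries_EFin; exact: avoid_self_cvg. Qed.

Lemma kac_formula : limn (series u) * pi i = 1.
Proof. exact: limit_mpow_mean_avoid avoid_self_cvg. Qed.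

(** By [fundamental_mxB], each term is [pi i] times a taboo probability times an expected hitting
    time. Summing over states first, [survival_avoid] leaves the tail of [series u] from [theta]
    on. *)
Lemma survival_Gamma theta : (0 < theta)%N ->
  (P (survival R X i theta) * Gamma P X p pi i theta =
   (pi i * (limn (series u) - series u theta))%:E)%E.
Proof.
(* At a positive time survival excludes the state [i], so summing over [[set~ i]] loses no mass; at
   time 0 all of it would be lost. *)
case: theta => // theta _.
set a := survival_at P X i theta.+1.
have u_ge0 n : 0 <= u n by exact: avoid0.
have a0 q : 0 <= a q by exact: survival_at_ge0.
have pi0 : 0 <= pi i by exact: mpow_limit_ge0 hp hZ.
have as_le q : a q <= u theta.+1.
  rewrite -lee_fin -survE (survival_atE _ _ _ hX).
  apply: le_measure; rewrite ?inE//.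
    by apply: measurableI; [exact: (measurable_survival _ _ _ hX)|exact: hX.1].
  exact: (measurable_survival _ _ _ hX).
(* Holds also when the survival event is null and [cond_prob] is 0. *)
have condE q : u theta.+1 * cond_prob P (X theta.+1 @^-1` [set q])
    (survival R X i theta.+1) = a q.
  rewrite /cond_prob survE setIC -/(survival_at P X i theta.+1 q) -/a/= mulrC.
  have [us|us] := eqVneq (u theta.+1) 0; last by rewrite divfK.
  by apply/eqP; rewrite us mulr0 eq_sym eq_le a0 -us as_le.
have cond_ge0 q : 0 <= cond_prob P (X theta.+1 @^-1` [set q])
    (survival R X i theta.+1).
  by rewrite divr_ge0// fine_ge0.
have U_ge0 q : cvgn (series (fun n => avoid p i n q)) ->
    0 <= limn (series (fun n => avoid p i n q)).
  move=> cq; rewrite -lee_fin -nneseries_EFin//.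
  by apply: nneseries_ge0 => n _ _; rewrite lee_fin.
have term q : q != i ->
    ((u theta.+1)%:E * (Num.max (cond_prob P (X theta.+1 @^-1` [set q])
       (survival R X i theta.+1) *
       (fundamental_mx p pi i i - fundamental_mx p pi q i)) 0)%:E =
    \esum_(n in [set: nat]) (pi i)%:E * (a q * avoid p i n q)%:E)%E.
  move=> qi.
  have [cq <-] := fundamental_mxB _ pi _ hp hZ q avoid_self_cvg qi.
  rewrite max_l; last by rewrite mulr_ge0// mulr_ge0// U_ge0.
  rewrite esumZl// => [|n]; last by rewrite lee_fin mulr_ge0.
  rewrite (eq_esum (b := fun n => ((a q)%:E * (avoid p i n q)%:E)%E))//.
  rewrite esumZl// => [|n]; last by rewrite lee_fin.
  rewrite -nneseries_esumT => [|n]; last by rewrite lee_fin.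
  by rewrite nneseries_EFin// -!EFinM -condE; congr EFin; ring.
(* Each [Z_ii - Z_qi] is [pi i] times an expected hitting time, hence nonnegative: the negative part
   of the signed sum is 0. *)
rewrite /Gamma /signed_esum [X in (_ - X)%E]esum1 ?sube0; last first.
  move=> q /eqP qi; have [cq <-] := fundamental_mxB _ pi _ hp hZ q avoid_self_cvg qi.
  by rewrite max_r// oppr_le0 mulr_ge0// mulr_ge0// U_ge0.
rewrite survE -esumZl// => [|q]; last by rewrite lee_fin le_max lexx orbT.
rewrite (eq_esum (b := fun q => \esum_(n in [set: nat])
  (pi i)%:E * (a q * avoid p i n q)%:E)%E) => [|q /eqP]; last exact: term.
have a_ge0 q n : (0 <= (a q * avoid p i n q)%:E)%E by rewrite lee_fin mulr_ge0.
rewrite esum_exchange => [|q n]; last by rewrite mule_ge0// lee_fin.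
(* For fixed [n] the sum extends to all states because [a i = 0], and [survival_avoid] evaluates
   it. *)
rewrite (eq_esum (b := fun n => (pi i)%:E * (u (n + theta.+1)%N)%:E)%E); last first.
  move=> n _; rewrite esumZl//; congr (_ * _)%E.
  rewrite addnC -survE -(survival_avoid _ _ _ hp hX) [LHS]esum_mkcond.
  apply: eq_esum => q _; have [->|/eqP qi] := eqVneq q i.
    by rewrite memNset/= ?survival_at_self ?mul0r//; apply.
  by rewrite mem_set.
have u0 n : (0 <= (u n)%:E)%E by rewrite lee_fin.
rewrite esumZl// -nneseries_esumT// (@nneseries_addn R (fun n => (u n)%:E))//.
have := @nneseries_split R (fun n => (u n)%:E) 0 theta.+1 (fun n _ => u0 n).
rewrite (nneseries_EFin _ _ avoid_self_cvg) add0n sumEFin => E.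
rewrite EFinM EFinB E; congr (_ * _)%E.
by rewrite addeAC subee// add0e.
Qed.

End Excess.

(** * The truncation bias, from the excess formula and Kac's formula *)

Theorem lemma10 (R : realType) (S : countType)
    (d : measure_display) (Omega : measurableType d)
    (Pr_ : S -> probability Omega R) (X : nat -> Omega -> S)
    (p : S -> S -> R) (pi : S -> R)
    (hX : markov_family Pr_ X p)
    (hirr : irreducible_chain p)
    (hrec : positive_recurrent Pr_ X)
    (hpi : stationary p pi)
    (i : S)
    (hZ : forall j : S, cvgn (fundamental_series p pi j i))
    (k : nat) (hk : (0 < k)%N)
    (d' : measure_display) (Omega' : measurableType d')
    (Q : probability Omega' R) (N : {RV Q >-> nat}) (Y : nat -> {RV Q >-> R})
    (hY : independent_copies (Pr_ i) (truncated_return_time X i (2 ^ k)%N) N Y) :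
  (1 - 'E_Q[sample_average N Y] / mean_return_time (Pr_ i) X i
   = Pr_ i (survival R X i (2 ^ k)%N) * Gamma (Pr_ i) X p pi i (2 ^ k)%N)%E.
Proof.
have [hp hXj] := hX; have [h0 hm] := hXj i.
have hi := hrec i; have theta_gt0 : (0 < 2 ^ k)%N by rewrite expn_gt0.
rewrite (survival_Gamma _ _ _ _ _ hp hm h0 hi hZ)//.
rewrite (mean_return_timeE _ _ _ _ hp hm h0 hi).
rewrite (expectation_sample_average _ _ _ _ _ (2 ^ k)%N hY); last first.
  by rewrite truncated_return_time_nat probability_setT.
rewrite (eq_bigr (fun n : 'I_(2 ^ k) => (avoid p i n i)%:E)) => [|n _]; last first.
  by rewrite truncated_return_time_gt// (survival_start _ _ _ hp hm).
have := kac_formula _ _ _ _ _ hp hm h0 hi hZ.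
set U := limn _ => UE.
(* With [U] nonzero, the extended inverse [inver] is the real inverse. *)
have U0 : U != 0.
  apply/eqP => U0; move: UE; rewrite U0 mul0r => /eqP.
  by rewrite eq_sym oner_eq0.
rewrite sumEFin -(big_mkord xpredT (fun n => avoid p i n i)) inver (negbTE U0).
rewrite -EFinM -EFinB; congr EFin.
(* Kac's formula turns [pi i] times the excess into 1 minus the ratio of the truncated mean to
   [U]. *)
have -> : pi i = U^-1 by rewrite -[RHS]mul1r -UE mulrAC mulfV ?mul1r.
by rewrite mulrBr mulVf// [in RHS]mulrC.
Qed.
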